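(* Let $\mathcal{C}$ be an additive category which has cokernels and pseudo-kernels, and assume that $\underline{\mathrm{mod}}(\mathcal{C})$ is a Serre subcategory of $\mathrm{mod}(\mathcal{C})$. Then the functor $r:\mathrm{mod}(\mathcal{C})\to\underline{\mathrm{mod}}(\mathcal{C})$ is a right adjoint of the inclusion functor $i:\underline{\mathrm{mod}}(\mathcal{C})\to\mathrm{mod}(\mathcal{C})$.
   Context: $\mathcal{C}$ is a small category (relative to a fixed universe). $\mathrm{Mod}(\mathcal{C})$ is the category of additive functors $\mathcal{C}^{\mathrm{op}}\to\mathrm{Ab}$. A functor $F\in\mathrm{Mod}(\mathcal{C})$ is coherent if there is an exact sequence $\mathrm{Hom}_{\mathcal{C}}(-,A)\to\mathrm{Hom}_{\mathcal{C}}(-,B)\to F\to 0$ (a presentation of $F$) with $A,B\in\mathcal{C}$; $\mathrm{mod}(\mathcal{C})$ is the full subcategory of coherent functors. When $\mathcal{C}$ has cokernels, the Yoneda functor $h_{\mathcal{C}}:\mathcal{C}\to\mathrm{mod}(\mathcal{C})$, $A\mapsto\mathrm{Hom}_{\mathcal{C}}(-,A)$, has a left adjoint $v:\mathrm{mod}(\mathcal{C})\to\mathcal{C}$, given by $v(F)=\mathrm{Coker}(X\to Y)$ for a presentation $\mathrm{Hom}_{\mathcal{C}}(-,X)\to\mathrm{Hom}_{\mathcal{C}}(-,Y)\to F\to 0$. $\underline{\mathrm{mod}}(\mathcal{C})$ is the full subcategory of those $F\in\mathrm{mod}(\mathcal{C})$ with $v(F)=0$. A morphism $B\to A$ in $\mathcal{C}$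 is a pseudo-kernel of a morphism $A\to C$ if the induced sequence $\mathrm{Hom}_{\mathcal{C}}(-,B)\to\mathrm{Hom}_{\mathcal{C}}(-,A)\to\mathrm{Hom}_{\mathcal{C}}(-,C)$ is exact; $\mathcal{C}$ has pseudo-kernels if every morphism has one, and then $\mathrm{mod}(\mathcal{C})$ is abelian (Freyd). A full subcategory of $\mathrm{mod}(\mathcal{C})$ is Serre if it is closed under subobjects, quotients and extensions. For $F\in\mathrm{mod}(\mathcal{C})$, $\eta_F:F\to L(F)=h_{\mathcal{C}}v(F)=\mathrm{Hom}_{\mathcal{C}}(-,v(F))$ is the canonical morphism (the unit of the adjunction); its kernel and cokernel lie in $\underline{\mathrm{mod}}(\mathcal{C})$ under the Serre assumption. Put $r(F)=\mathrm{Ker}\,\eta_F$; for a morphism $f:F\to G$, $r(f):r(F)\to r(G)$ is the induced morphism.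
   Formalization: The formal statement additionally assumes that Ker η_F has v(Ker η_F)=0 for every coherent F, i.e. that r really takes values in the subcategory of F with v(F)=0; this does not follow from the Serre assumption alone, and without it r is not defined as stated. *)

(* Defs.v *)
From HB Require Import structures.
From mathcomp Require Import all_boot all_algebra.
From mathcomp Require Import boolp.
Set Implicit Arguments.
Unset Strict Implicit.
Unset Printing Implicit Defensive.
Import GRing.Theory.
Local Open Scope ring_scope.

(** * Categories with zero morphisms *)

(* Zero morphisms in the sense of [zeromL], [zeromR] are unique when they
   exist, so [zerom] is a property of the category, not an extra choice. *)
Record category := Category {
  obj :> Type;
  hom : obj -> obj -> Type;
  idm : forall A, hom A A;
  comp : forall A B D, hom B D -> hom A B -> hom A D;
  zerom : forall A B, hom A B;
  compA : forall A B D E (h : hom D E) (g : hom B D) (f : hom A B),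
    comp h (comp g f) = comp (comp h g) f;
  comp1m : forall A B (f : hom A B), comp (idm B) f = f;
  compm1 : forall A B (f : hom A B), comp f (idm A) = f;
  zeromL : forall A B D (f : hom A B), comp (zerom B D) f = zerom A D;
  zeromR : forall A B D (g : hom B D), comp g (zerom A B) = zerom A D }.
Arguments idm {_} A.
Arguments zerom {_} A B.

Notation "g ∘ f" := (comp g f) (at level 40, left associativity).

Definition is_zero_obj (D : category) (Z : D) : Prop :=
  forall A : D, (exists! f : hom A Z, True) /\ (exists! f : hom Z A, True).

Definition mono (D : category) (A B : D) (m : hom A B) : Prop :=
  forall (X : D) (f g : hom X A), m ∘ f = m ∘ g -> f = g.

Definition epi (D : category) (A B : D) (e : hom A B) : Prop :=
  forall (X : D) (f g : hom B X), f ∘ e = g ∘ e -> f = g.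

Definition is_kernel (D : category) (K A B : D) (k : hom K A) (f : hom A B) :
    Prop :=
  f ∘ k = zerom K B /\
  forall (X : D) (g : hom X A), f ∘ g = zerom X B -> exists! u : hom X K, k ∘ u = g.

Definition is_cokernel (D : category) (A B Q : D) (f : hom A B) (c : hom B Q) :
    Prop :=
  c ∘ f = zerom A Q /\
  forall (X : D) (g : hom B X), g ∘ f = zerom A X -> exists! u : hom Q X, u ∘ c = g.

Definition has_cokernels (D : category) : Prop :=
  forall (A B : D) (f : hom A B), exists (Q : D) (c : hom B Q), is_cokernel f c.

(* [0 -> A -> B -> D -> 0] is short exact *)
Definition short_exact (E : category) (A B D : E) (f : hom A B) (g : hom B D) :
    Prop :=
  is_kernel f g /\ is_cokernel f g.

(* Full subcategories are given by the predicate cutting out their objects *)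
Definition serre (E : category) (P : E -> Prop) : Prop :=
  [/\ forall (A B : E) (m : hom A B), mono m -> P B -> P A,
      forall (A B : E) (e : hom A B), epi e -> P A -> P B &
      forall (A B D : E) (f : hom A B) (g : hom B D),
        short_exact f g -> P A -> P D -> P B].

Definition full_sub (D : category) (P : D -> Prop) : category :=
  @Category {X : D | P X} (fun X Y => hom (sval X) (sval Y))
    (fun X => idm (sval X)) (fun _ _ _ g f => g ∘ f)
    (fun X Y => zerom (sval X) (sval Y))
    (fun _ _ _ _ h g f => compA h g f) (fun _ _ f => comp1m f)
    (fun _ _ f => compm1 f) (fun _ _ Z f => zeromL (sval Z) f)
    (fun X _ _ g => zeromR (sval X) g).

(** * Functors and adjunctions *)

Record functor (D E : category) := Functor {
  fobj :> D -> E;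
  fmap : forall X Y : D, hom X Y -> hom (fobj X) (fobj Y);
  fmap1 : forall X : D, fmap (idm X) = idm (fobj X);
  fmapM : forall (X Y Z : D) (g : hom Y Z) (f : hom X Y),
    fmap (g ∘ f) = fmap g ∘ fmap f }.
Arguments fmap {D E} f {X Y} : rename.

Definition incl (D : category) (P : D -> Prop) : functor (full_sub P) D :=
  @Functor (full_sub P) D (fun X => sval X) (fun _ _ f => f)
    (fun _ => erefl) (fun _ _ _ _ _ => erefl).

Definition corestrict (D E : category) (P : E -> Prop) (F : functor D E)
    (FP : forall X, P (F X)) : functor D (full_sub P) :=
  @Functor D (full_sub P) (fun X => exist P (F X) (FP X))
    (fun _ _ f => fmap F f) (fun X => fmap1 F X) (fun _ _ _ g f => fmapM F g f).

Record adjunction (D E : category) (L : functor D E) (R : functor E D) :=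
  Adjunction {
    adj : forall (X : D) (Y : E), hom (L X) Y -> hom X (R Y);
    adj_bij : forall (X : D) (Y : E), bijective (@adj X Y);
    adj_nat : forall (X X' : D) (Y Y' : E)
      (f : hom X' X) (h : hom (L X) Y) (g : hom Y Y'),
      adj (g ∘ h ∘ fmap L f) = fmap R g ∘ adj h ∘ f }.

Definition adj_unit (D E : category) (L : functor D E) (R : functor E D)
    (a : adjunction L R) (X : D) : hom X (R (L X)) :=
  adj a (idm (L X)).

Definition is_right_adjoint (D E : category) (R : functor E D)
    (L : functor D E) : Prop :=
  inhabited (adjunction L R).

Definition universal (D E : category) (R : functor E D) (X : D) (Y : E)
    (e : hom X (R Y)) : Prop :=
  forall (Z : E) (f : hom X (R Z)), exists! g : hom Y Z, fmap R g ∘ e = f.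

(* A choice of universal arrows to [R] makes a left adjoint of [R]. *)
Definition univ_lift (D E : category) (R : functor E D) (X : D) (Y : E)
    (e : hom X (R Y)) (u : universal e) (Z : E) (f : hom X (R Z)) : hom Y Z :=
  sval (cid (u Z f)).

Lemma univ_liftK (D E : category) (R : functor E D) (X : D) (Y : E)
    (e : hom X (R Y)) (u : universal e) (Z : E) (f : hom X (R Z)) :
  fmap R (univ_lift u f) ∘ e = f.
Proof. by rewrite /univ_lift; case: cid => g []. Qed.

Lemma univ_inj (D E : category) (R : functor E D) (X : D) (Y : E)
    (e : hom X (R Y)) (u : universal e) (Z : E) (g h : hom Y Z) :
  fmap R g ∘ e = fmap R h ∘ e -> g = h.
Proof.
move=> gh; have [k [_ ku]] := u Z (fmap R h ∘ e).
by rewrite -(ku g gh) -(ku h erefl).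
Qed.

Lemma ladj_map1 (D E : category) (R : functor E D) (L : D -> E)
    (e : forall X, hom X (R (L X))) (u : forall X, universal (e X)) (X : D) :
  univ_lift (u X) (e X ∘ idm X) = idm (L X).
Proof. by apply: (univ_inj (u X)); rewrite univ_liftK fmap1 comp1m compm1. Qed.

Lemma ladj_mapM (D E : category) (R : functor E D) (L : D -> E)
    (e : forall X, hom X (R (L X))) (u : forall X, universal (e X))
    (X Y Z : D) (g : hom Y Z) (f : hom X Y) :
  univ_lift (u X) (e Z ∘ (g ∘ f))
  = univ_lift (u Y) (e Z ∘ g) ∘ univ_lift (u X) (e Y ∘ f).
Proof.
apply: (univ_inj (u X)).
by rewrite univ_liftK fmapM -compA univ_liftK [in RHS]compA univ_liftK compA.
Qed.

Definition ladj (D E : category) (R : functor E D) (L : D -> E)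
    (e : forall X, hom X (R (L X))) (u : forall X, universal (e X)) :
    functor D E :=
  @Functor D E L (fun X Y f => univ_lift (u X) (e Y ∘ f))
    (ladj_map1 u) (ladj_mapM u).

Lemma ladj_bij (D E : category) (R : functor E D) (L : D -> E)
    (e : forall X, hom X (R (L X))) (u : forall X, universal (e X))
    (X : D) (Y : E) :
  bijective (fun h : hom (ladj u X) Y => fmap R h ∘ e X).
Proof.
exists (fun f => univ_lift (u X) f) => [h|f]; last exact: univ_liftK.
by apply: (univ_inj (u X)); rewrite univ_liftK.
Qed.

Lemma ladj_nat (D E : category) (R : functor E D) (L : D -> E)
    (e : forall X, hom X (R (L X))) (u : forall X, universal (e X))
    (X X' : D) (Y Y' : E) (f : hom X' X) (h : hom (ladj u X) Y) (g : hom Y Y') :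
  fmap R (g ∘ h ∘ fmap (ladj u) f) ∘ e X' = fmap R g ∘ (fmap R h ∘ e X) ∘ f.
Proof. by rewrite !fmapM -!compA univ_liftK. Qed.

Definition ladj_adj (D E : category) (R : functor E D) (L : D -> E)
    (e : forall X, hom X (R (L X))) (u : forall X, universal (e X)) :
    adjunction (ladj u) R :=
  Adjunction (ladj_bij u) (@ladj_nat D E R L e u).

(** * Additive categories *)

(* [zmodType] carries a choice structure, which by the axioms of [boolp] every
   type has, so this does not restrict the groups of morphisms. *)
Record preadditive := Preadditive {
  pobj :> Type;
  phom : pobj -> pobj -> zmodType;
  pidm : forall A, phom A A;
  pcomp : forall A B D, phom B D -> phom A B -> phom A D;
  pcompA : forall A B D E (h : phom D E) (g : phom B D) (f : phom A B),
    pcomp h (pcomp g f) = pcomp (pcomp h g) f;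
  pcomp1m : forall A B (f : phom A B), pcomp (pidm B) f = f;
  pcompm1 : forall A B (f : phom A B), pcomp f (pidm A) = f;
  pcompDl : forall A B D (g h : phom B D) (f : phom A B),
    pcomp (g + h) f = pcomp g f + pcomp h f;
  pcompDr : forall A B D (h : phom B D) (f g : phom A B),
    pcomp h (f + g) = pcomp h f + pcomp h g }.
Arguments pidm {_} A.

Lemma pcomp0m (C : preadditive) (A B D : C) (f : phom A B) :
  pcomp (0 : phom B D) f = 0.
Proof. by apply: (addrI (pcomp 0 f)); rewrite -pcompDl !addr0. Qed.

Lemma pcompm0 (C : preadditive) (A B D : C) (g : phom B D) :
  pcomp g (0 : phom A B) = 0.
Proof. by apply: (addrI (pcomp g 0)); rewrite -pcompDr !addr0. Qed.

Lemma pcompBl (C : preadditive) (A B D : C) (f : phom A B) :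
  zmod_morphism (fun g : phom B D => pcomp g f).
Proof.
move=> g h; apply: (addIr (pcomp h f)).
by rewrite -pcompDl !subrK.
Qed.

Lemma pcompBr (C : preadditive) (A B D : C) (h : phom B D) :
  zmod_morphism (fun f : phom A B => pcomp h f).
Proof.
move=> f g; apply: (addIr (pcomp h g)).
by rewrite -pcompDr !subrK.
Qed.

Definition cat_of (C : preadditive) : category :=
  @Category C (fun A B => phom A B) (@pidm C) (@pcomp C) (fun A B => 0)
    (@pcompA C) (@pcomp1m C) (@pcompm1 C)
    (fun A B D => @pcomp0m C A B D) (fun A B D => @pcompm0 C A B D).
Coercion cat_of : preadditive >-> category.

Definition has_biproducts (C : preadditive) : Prop :=
  forall A B : C, exists (P : C) (i1 : phom A P) (i2 : phom B P)
      (p1 : phom P A) (p2 : phom P B),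
    [/\ pcomp p1 i1 = pidm A, pcomp p2 i2 = pidm B, pcomp p1 i2 = 0,
        pcomp p2 i1 = 0 & pcomp i1 p1 + pcomp i2 p2 = pidm P].

Definition additive_category (C : preadditive) : Prop :=
  (exists Z : C, @is_zero_obj C Z) /\ has_biproducts C.

(** * Mod(C) *)

(* additive functors from the opposite of [C] to abelian groups *)
Record cmod (C : preadditive) := CMod {
  cobj :> C -> zmodType;
  cmap : forall A B : C, phom A B -> {additive cobj B -> cobj A};
  cmap1 : forall (A : C) (x : cobj A), cmap (pidm A) x = x;
  cmapM : forall (A B D : C) (g : phom B D) (f : phom A B) (x : cobj D),
    cmap (pcomp g f) x = cmap f (cmap g x);
  cmapD : forall (A B : C) (f g : phom A B) (x : cobj B),
    cmap (f + g) x = cmap f x + cmap g x }.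
Arguments cmap {C} c {A B} f : rename.

Record cmod_hom (C : preadditive) (F G : cmod C) := CModHom {
  cfun :> forall A : C, {additive F A -> G A};
  cfun_nat : forall (A B : C) (f : phom A B) (x : F B),
    cfun A (cmap F f x) = cmap G f (cfun B x) }.

Lemma additive_ext (U V : zmodType) (f g : {additive U -> V}) : f =1 g -> f = g.
Proof.
case: f => f [[mf]]; case: g => g [[mg]] /= fg.
have {}fg : f = g by exact: funext.
by rewrite fg in mf *; rewrite (Prop_irrelevance mf mg).
Qed.

Lemma cmod_hom_ext (C : preadditive) (F G : cmod C) (u w : cmod_hom F G) :
  (forall A (x : F A), u A x = w A x) -> u = w.
Proof.
case: u w => u un [w wn] /= uw.
have {}uw : u = w by apply: functional_extensionality_dep => A; apply: additive_ext => x; exact: uw.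
by rewrite uw in un *; rewrite (Prop_irrelevance un wn).
Qed.

Definition cmod_id (C : preadditive) (F : cmod C) : cmod_hom F F :=
  @CModHom C F F (fun A => idfun : {additive F A -> F A}) (fun _ _ _ _ => erefl).

Lemma cmod_comp_nat (C : preadditive) (F G H : cmod C)
    (w : cmod_hom G H) (u : cmod_hom F G) (A B : C) (f : phom A B) (x : F B) :
  w A (u A (cmap F f x)) = cmap H f (w B (u B x)).
Proof. by rewrite !cfun_nat. Qed.

Definition cmod_comp (C : preadditive) (F G H : cmod C)
    (w : cmod_hom G H) (u : cmod_hom F G) : cmod_hom F H :=
  @CModHom C F H (fun A => (w A \o u A : {additive F A -> H A}))
    (cmod_comp_nat w u).

Lemma cmod_zero_nat (C : preadditive) (F G : cmod C) (A B : C) (f : phom A B)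
    (x : F B) :
  (0 : G A) = cmap G f 0.
Proof. by rewrite raddf0. Qed.

Definition cmod_zero (C : preadditive) (F G : cmod C) : cmod_hom F G :=
  @CModHom C F G (fun A => (\0 : {additive F A -> G A}))
    (@cmod_zero_nat C F G).

Lemma cmod_zeromR (C : preadditive) (F G H : cmod C) (w : cmod_hom G H) :
  cmod_comp w (cmod_zero F G) = cmod_zero F H.
Proof. by apply: cmod_hom_ext => A x /=; rewrite raddf0. Qed.

Definition Mod (C : preadditive) : category.
Proof.
refine (@Category (cmod C) (@cmod_hom C) (@cmod_id C) (@cmod_comp C)
  (@cmod_zero C) _ _ _ _ (@cmod_zeromR C)).
- by move=> *; apply: cmod_hom_ext.
- by move=> *; apply: cmod_hom_ext.
- by move=> *; apply: cmod_hom_ext.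
- by move=> *; apply: cmod_hom_ext.
Defined.

(** * Representable functors *)

Definition precomp (C : preadditive) (A B X : C) (f : phom A B)
    (g : phom B X) : phom A X := pcomp g f.
HB.instance Definition _ (C : preadditive) (A B X : C) (f : phom A B) :=
  GRing.isZmodMorphism.Build (phom B X) (phom A X) (precomp f)
    (@pcompBl C A B X f).

Definition postcomp (C : preadditive) (A X Y : C) (g : phom X Y)
    (f : phom A X) : phom A Y := pcomp g f.
HB.instance Definition _ (C : preadditive) (A X Y : C) (g : phom X Y) :=
  GRing.isZmodMorphism.Build (phom A X) (phom A Y) (postcomp g)
    (@pcompBr C A X Y g).

Definition rep (C : preadditive) (X : C) : cmod C :=
  @CMod C (fun A => phom A X)
    (fun A B f => (precomp f : {additive phom B X -> phom A X}))
    (fun A x => pcompm1 x) (fun A B D g f x => pcompA x g f)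
    (fun A B f g x => pcompDr x f g).

Definition rep_map (C : preadditive) (X Y : C) (g : phom X Y) :
    cmod_hom (rep X) (rep Y) :=
  @CModHom C (rep X) (rep Y)
    (fun A => (postcomp g : {additive phom A X -> phom A Y}))
    (fun A B f x => pcompA g x f).

(** * Coherent functors *)

Definition exact_seq (C : preadditive) (F G H : cmod C)
    (u : cmod_hom F G) (w : cmod_hom G H) : Prop :=
  forall (A : C) (y : G A), w A y = 0 <-> exists x : F A, u A x = y.

Definition cmod_surj (C : preadditive) (F G : cmod C) (u : cmod_hom F G) : Prop :=
  forall (A : C) (y : G A), exists x : F A, u A x = y.

(* [Hom(-,X) -> Hom(-,Y) -> F -> 0] exact; by the Yoneda lemma the first map is
   composition with a morphism [X -> Y]. *)
Record presentation (C : preadditive) (F : cmod C) := Presentation {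
  pres_src : C;
  pres_tgt : C;
  pres_mor : phom pres_src pres_tgt;
  pres_epi : cmod_hom (rep pres_tgt) F;
  pres_exact : exact_seq (rep_map pres_mor) pres_epi;
  pres_surj : cmod_surj pres_epi }.
Arguments pres_exact {C F} p {A} y.
Arguments pres_surj {C F} p {A} y.

Definition coherent (C : preadditive) (F : cmod C) : Prop :=
  inhabited (presentation F).

Definition cohmod (C : preadditive) : category :=
  @full_sub (Mod C) (@coherent C).

Definition choose_pres (C : preadditive) (F : cohmod C) : presentation (sval F) :=
  sval (cid (let: inhabits p := proj2_sig F in ex_intro xpredT p isT)).

Definition has_pseudokernels (C : preadditive) : Prop :=
  forall (A D : C) (a : phom A D), exists (B : C) (b : phom B A),
    exact_seq (rep_map b) (rep_map a).

Lemma zero_obj_hom (C : preadditive) (Z : C) :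
  @is_zero_obj C Z -> forall (A : C) (f : phom A Z), f = 0.
Proof. by move=> Z0 A f; have [[z [_ zu]] _] := Z0 A; rewrite -(zu f) // -(zu 0). Qed.

Lemma rep_coherent (C : preadditive) (addC : additive_category C) (X : C) :
  coherent (rep X).
Proof.
have [[Z Z0] _] := addC.
apply: inhabits; exists Z X 0 (cmod_id (rep X)) => [A y|A y]; last by exists y.
split=> [/= -> | [x /= <-]]; last exact: pcomp0m.
by exists 0; rewrite /= raddf0.
Qed.

Lemma rep_map1 (C : preadditive) (X : C) : rep_map (pidm X) = cmod_id (rep X).
Proof. by apply: cmod_hom_ext => A x; exact: pcomp1m. Qed.

Lemma rep_mapM (C : preadditive) (X Y Z : C) (g : phom Y Z) (f : phom X Y) :
  rep_map (pcomp g f) = cmod_comp (rep_map g) (rep_map f).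
Proof. by apply: cmod_hom_ext => A x; rewrite /= /postcomp pcompA. Qed.

Definition yoneda (C : preadditive) (addC : additive_category C) :
    functor C (cohmod C) :=
  @Functor C (cohmod C) (fun X => exist _ (rep X) (rep_coherent addC X))
    (@rep_map C) (@rep_map1 C) (@rep_mapM C).

(** * The left adjoint [v] of the Yoneda functor *)

Definition choose_coker (C : category) (cokC : has_cokernels C) (A B : C)
    (f : hom A B) : {Q : C & {c : hom B Q | is_cokernel f c}} :=
  let: exist Q cQ := cid (cokC A B f) in existT _ Q (cid cQ).

Lemma pres_desc_ex (C : preadditive) (F : cmod C) (p : presentation F) (Q : C)
    (c : phom (pres_tgt p) Q) :
  pcomp c (pres_mor p) = 0 ->
  exists! u : cmod_hom F (rep Q), cmod_comp u (pres_epi p) = rep_map c.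
Proof.
move=> c0; pose s A (y : F A) := sval (cid (pres_surj p y)).
have sK A (y : F A) : pres_epi p A (s A y) = y by rewrite /s; case: cid.
have wd A (x y : phom A (pres_tgt p)) :
    pres_epi p A x = pres_epi p A y -> pcomp c x = pcomp c y.
  move=> xy; apply/eqP; rewrite -subr_eq0 -[_ - _](raddfB (postcomp c)).
  have /(pres_exact p _)[z <-] : pres_epi p A (x - y) = 0.
    by rewrite raddfB xy subrr.
  by rewrite /= /postcomp pcompA c0 pcomp0m.
pose uf A (y : F A) : rep Q A := pcomp c (s A y).
have uB A : zmod_morphism (uf A).
  move=> x y; rewrite /uf -[RHS](raddfB (postcomp c)); apply: wd.
  by rewrite raddfB !sK.
pose ua A : {additive F A -> rep Q A} := HB.pack (uf A)
  (GRing.isZmodMorphism.Build (F A) (rep Q A) (uf A) (uB A)).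
have un (A B : C) (f : phom A B) (x : F B) :
    ua A (cmap F f x) = cmap (rep Q) f (ua B x).
  rewrite /= /uf /precomp -pcompA; apply: wd; rewrite sK.
  by rewrite (cfun_nat (pres_epi p) f (s B x)) sK.
exists (CModHom un); split.
  by apply: cmod_hom_ext => A x /=; apply: wd; rewrite sK.
move=> w wc; apply: cmod_hom_ext => A x /=.
by rewrite /uf -[LHS]/(rep_map c A (s A x)) -wc /= sK.
Qed.

Definition v_data (C : preadditive) (cokC : has_cokernels C) (F : cohmod C) :=
  choose_coker cokC (pres_mor (choose_pres F)).

Definition v_obj (C : preadditive) (cokC : has_cokernels C) (F : cohmod C) : C :=
  projT1 (v_data cokC F).

Definition v_coker (C : preadditive) (cokC : has_cokernels C) (F : cohmod C) :
    phom (pres_tgt (choose_pres F)) (v_obj cokC F) :=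
  sval (projT2 (v_data cokC F)).

Lemma v_cokerP (C : preadditive) (cokC : has_cokernels C) (F : cohmod C) :
  @is_cokernel C _ _ _ (pres_mor (choose_pres F)) (v_coker cokC F).
Proof. by rewrite /v_coker; case: (projT2 _). Qed.

(* the map induced on [F] by composition with [Y -> Coker (X -> Y)] *)
Definition v_unit (C : preadditive) (addC : additive_category C)
    (cokC : has_cokernels C) (F : cohmod C) :
    hom F (yoneda addC (v_obj cokC F)) :=
  sval (cid (pres_desc_ex (proj1 (v_cokerP cokC F)))).

Lemma v_unitE (C : preadditive) (addC : additive_category C)
    (cokC : has_cokernels C) (F : cohmod C) :
  cmod_comp (v_unit addC cokC F) (pres_epi (choose_pres F))
  = rep_map (v_coker cokC F).
Proof. by rewrite /v_unit; case: cid => u []. Qed.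

Lemma yoneda_ext (C : preadditive) (X Y : C) (g h : phom X Y) :
  rep_map g = rep_map h -> g = h.
Proof.
move=> gh; have := congr1 (fun u : cmod_hom (rep X) (rep Y) => u X (pidm X)) gh.
by rewrite /= /postcomp !pcompm1.
Qed.

Lemma yoneda_full (C : preadditive) (X Y : C) (u : cmod_hom (rep X) (rep Y)) :
  u = rep_map (u X (pidm X)).
Proof.
apply: cmod_hom_ext => A x.
by have := cfun_nat u x (pidm X); rewrite /= /precomp pcomp1m.
Qed.

Lemma pres_epi_cancel (C : preadditive) (F G : cmod C) (p : presentation F)
    (u w : cmod_hom F G) :
  cmod_comp u (pres_epi p) = cmod_comp w (pres_epi p) -> u = w.
Proof.
move=> uw; apply: cmod_hom_ext => A y; have [x <-] := pres_surj p y.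
exact: (congr1 (fun t : cmod_hom (rep (pres_tgt p)) G => t A x) uw).
Qed.

Lemma pres_epi_mor (C : preadditive) (F : cmod C) (p : presentation F) :
  cmod_comp (pres_epi p) (rep_map (pres_mor p)) = cmod_zero _ _.
Proof. by apply: cmod_hom_ext => A x; apply/(pres_exact p _); exists x. Qed.

Lemma v_universal (C : preadditive) (addC : additive_category C)
    (cokC : has_cokernels C) (F : cohmod C) :
  @universal _ _ (yoneda addC) _ _ (v_unit addC cokC F).
Proof.
move=> Z f; set p := choose_pres F.
have [c0 cu] := v_cokerP cokC F.
pose a := cfun (cmod_comp f (pres_epi p)) (pres_tgt p) (pidm _).
have fa : cmod_comp f (pres_epi p) = rep_map a by exact: yoneda_full.
have a0 : pcomp a (pres_mor p) = 0.
  apply: yoneda_ext; rewrite rep_mapM -fa.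
  have -> : rep_map 0 = cmod_zero (rep (pres_src p)) (rep Z).
    by apply: cmod_hom_ext => A x; exact: pcomp0m.
  rewrite -(cmod_zeromR _ f) -(pres_epi_mor p).
  exact: cmod_hom_ext.
have [g [ga gu]] := cu Z a a0.
exists g; split.
  apply: (@pres_epi_cancel C _ _ p); rewrite fa -ga [RHS]rep_mapM.
  by rewrite -(v_unitE addC); apply: cmod_hom_ext.
move=> h hf; apply: gu; apply: yoneda_ext.
by rewrite [LHS]rep_mapM -(v_unitE addC) -fa -hf; apply: cmod_hom_ext.
Qed.

Definition v (C : preadditive) (addC : additive_category C)
    (cokC : has_cokernels C) : functor (cohmod C) C :=
  ladj (@v_universal C addC cokC).

Definition v_adj (C : preadditive) (addC : additive_category C)
    (cokC : has_cokernels C) : adjunction (v addC cokC) (yoneda addC) :=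
  ladj_adj (@v_universal C addC cokC).

Definition eta (C : preadditive) (addC : additive_category C)
    (cokC : has_cokernels C) (F : cohmod C) :
    hom F (yoneda addC (v addC cokC F)) :=
  adj_unit (v_adj addC cokC) F.

(* the objects of the full subcategory of [cohmod C] written with an underlined
   "mod" *)
Definition v_zero (C : preadditive) (addC : additive_category C)
    (cokC : has_cokernels C) (F : cohmod C) : Prop :=
  is_zero_obj (v addC cokC F).

Definition umod (C : preadditive) (addC : additive_category C)
    (cokC : has_cokernels C) : category :=
  full_sub (v_zero addC cokC).

(** * Kernels in Mod(C) *)

Definition kerp (U V : zmodType) (f : {additive U -> V}) : {pred U} :=
  fun x => f x == 0.

Lemma kerp_zmod_closed (U V : zmodType) (f : {additive U -> V}) :
  zmod_closed (kerp f).
Proof.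
split=> [|x y]; rewrite !unfold_in /kerp ?raddf0 ?eqxx // => /eqP fx /eqP fy.
by rewrite raddfB fx fy subrr.
Qed.
HB.instance Definition _ (U V : zmodType) (f : {additive U -> V}) :=
  GRing.isZmodClosed.Build U (kerp f) (kerp_zmod_closed f).

Record kernel (U V : zmodType) (f : {additive U -> V}) :=
  Kernel { kval :> U; _ : kval \in kerp f }.
HB.instance Definition _ (U V : zmodType) (f : {additive U -> V}) :=
  [isSub for @kval U V f].
HB.instance Definition _ (U V : zmodType) (f : {additive U -> V}) :=
  [Choice of kernel f by <:].
HB.instance Definition _ (U V : zmodType) (f : {additive U -> V}) :=
  [SubChoice_isSubZmodule of kernel f by <:].

Lemma kvalP (U V : zmodType) (f : {additive U -> V}) (x : kernel f) : f (kval x) = 0.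
Proof. by case: x => x /= /eqP. Qed.

Lemma kval_inj (U V : zmodType) (f : {additive U -> V}) : injective (@kval U V f).
Proof. exact: val_inj. Qed.

Definition ker_fun (U V U' V' : zmodType) (f : {additive U -> V})
    (f' : {additive U' -> V'}) (a : {additive U -> U'})
    (af : forall x, f x = 0 -> f' (a x) = 0) (x : kernel f) : kernel f' :=
  Kernel (introT eqP (af (kval x) (kvalP x)) : a (kval x) \in kerp f').

Lemma ker_funB (U V U' V' : zmodType) (f : {additive U -> V})
    (f' : {additive U' -> V'}) (a : {additive U -> U'})
    (af : forall x, f x = 0 -> f' (a x) = 0) :
  zmod_morphism (ker_fun af).
Proof. by move=> x y; apply: val_inj; rewrite /= !raddfB. Qed.
HB.instance Definition _ (U V U' V' : zmodType) (f : {additive U -> V})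
    (f' : {additive U' -> V'}) (a : {additive U -> U'})
    (af : forall x, f x = 0 -> f' (a x) = 0) :=
  GRing.isZmodMorphism.Build (kernel f) (kernel f') (ker_fun af) (ker_funB af).

Lemma ker_stable (C : preadditive) (F G : cmod C) (u : cmod_hom F G)
    (A B : C) (f : phom A B) (x : F B) :
  u B x = 0 -> u A (cmap F f x) = 0.
Proof. by move=> ux; rewrite cfun_nat ux raddf0. Qed.

Definition Ker (C : preadditive) (F G : cmod C) (u : cmod_hom F G) : cmod C.
Proof.
refine (@CMod C (fun A => kernel (u A))
  (fun A B f => (ker_fun (@ker_stable C F G u A B f)
                  : {additive kernel (u B) -> kernel (u A)})) _ _ _).
- by move=> A x; apply: kval_inj; exact: cmap1.
- by move=> A B D g f x; apply: kval_inj; exact: cmapM.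
- by move=> A B f g x; apply: kval_inj; exact: cmapD.
Defined.

Definition Ker_incl (C : preadditive) (F G : cmod C) (u : cmod_hom F G) :
    cmod_hom (Ker u) F :=
  @CModHom C (Ker u) F
    (fun A => (val : {additive kernel (u A) -> F A})) (fun _ _ _ _ => erefl).

Lemma weak_pullback (C : preadditive) (addC : additive_category C)
    (pkC : has_pseudokernels C) (A B D : C) (a : phom A D) (b : phom B D) :
  exists (P : C) (q : phom P A), forall (T : C) (t : phom T A),
    (exists s : phom T B, pcomp a t = pcomp b s) <->
    (exists w : phom T P, pcomp q w = t).
Proof.
have [P [i1 [i2 [p1 [p2 [p11 p22 p12 p21 pE]]]]]] := proj2 addC A B.
have [K [k kE]] := pkC _ _ (pcomp a p1 - pcomp b p2).
have dE T (x : phom T P) : pcomp (pcomp a p1 - pcomp b p2) x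
    = pcomp a (pcomp p1 x) - pcomp b (pcomp p2 x).
  by rewrite pcompBl !pcompA.
exists K, (pcomp p1 k) => T t; split=> [[s st]|[w <-]].
  pose x := pcomp i1 t + pcomp i2 s.
  have x1 : pcomp p1 x = t.
    by rewrite pcompDr !pcompA p11 p12 pcomp0m pcomp1m addr0.
  have x2 : pcomp p2 x = s.
    by rewrite pcompDr !pcompA p21 p22 pcomp0m pcomp1m add0r.
  have /kE[w wE] : rep_map (pcomp a p1 - pcomp b p2) T x = 0.
    by rewrite /= /postcomp dE x1 x2 st subrr.
  by exists w; rewrite -pcompA -x1 -wE.
exists (pcomp p2 (pcomp k w)).
have /kE : exists z, rep_map k T z = pcomp k w by exists w.
by rewrite /= /postcomp dE => /eqP; rewrite subr_eq0 -pcompA => /eqP.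
Qed.

Lemma rep_hom_val (C : preadditive) (F : cmod C) (X : C)
    (w : cmod_hom (rep X) F) (A : C) (a : phom A X) :
  w A a = cmap F a (w X (pidm X)).
Proof. by rewrite -cfun_nat /= /precomp pcomp1m. Qed.

Lemma Ker_coherent (C : preadditive) (addC : additive_category C)
    (pkC : has_pseudokernels C) (F G : cmod C) (u : cmod_hom F G) :
  coherent F -> coherent G -> coherent (Ker u).
Proof.
move=> [p] [p'].
have [y yE] := pres_surj p' (u _ (pres_epi p (pres_tgt p) (pidm _))).
have upE A (a : phom A (pres_tgt p)) :
    u A (pres_epi p A a) = pres_epi p' A (pcomp y a).
  have := rep_hom_val (cmod_comp u (pres_epi p)) a; rewrite /= => ->.
  by rewrite -yE -cfun_nat.
have [Z [z zE]] := weak_pullback addC pkC y (pres_mor p').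
have [W [w wE]] := weak_pullback addC pkC z (pres_mor p).
have kerE A (a : phom A (pres_tgt p)) :
    u A (pres_epi p A a) = 0 <-> exists b : phom A Z, pcomp z b = a.
  rewrite upE -zE; split=> [/(pres_exact p' _)[s sE]|[s sE]].
    by exists s; exact: esym.
  by apply/(pres_exact p' _); exists s; rewrite sE.
have qP A (b : phom A Z) : pres_epi p A (pcomp z b) \in kerp (u A).
  by apply/eqP/kerE; exists b.
pose qf A (b : phom A Z) : kernel (u A) := Kernel (qP A b).
have qB A : zmod_morphism (qf A).
  by move=> b c; apply: val_inj; rewrite /= pcompBr raddfB.
pose qa A : {additive rep Z A -> Ker u A} := HB.pack (qf A)
  (GRing.isZmodMorphism.Build (rep Z A) (Ker u A) (qf A) (qB A)).
have qn (A B : C) (f : phom A B) (x : rep Z B) :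
    qa A (cmap (rep Z) f x) = cmap (Ker u) f (qa B x).
  apply: val_inj; rewrite /= /precomp pcompA.
  exact: (cfun_nat (pres_epi p) f (pcomp z x)).
apply: inhabits; exists W Z w (CModHom qn) => A.
- move=> b; rewrite /= /postcomp -wE; split=> [/(congr1 val) /= b0|[s bs]].
    have /(pres_exact p _)[s sE] := b0; by exists s; exact: esym.
  by apply: val_inj => /=; apply/(pres_exact p _); exists s; rewrite bs.
- move=> k; have [a aE] := pres_surj p (val k).
  have /kerE[b bE] : u A (pres_epi p A a) = 0 by rewrite aE; exact: kvalP.
  by exists b; apply: val_inj; rewrite /= bE.
Qed.

(** * The functor [r] *)

Lemma adj_unit_nat (D E : category) (L : functor D E) (R : functor E D)
    (a : adjunction L R) (X Y : D) (f : hom X Y) :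
  adj_unit a Y ∘ f = fmap R (fmap L f) ∘ adj_unit a X.
Proof.
have := adj_nat a f (idm (L Y)) (idm (L Y)).
rewrite fmap1 !comp1m => <-.
by have := adj_nat a (idm X) (idm (L X)) (fmap L f);
  rewrite fmap1 !compm1.
Qed.

Definition Ker_map (C : preadditive) (F G F' G' : cmod C) (u : cmod_hom F G)
    (u' : cmod_hom F' G') (a : cmod_hom F F')
    (au : forall A x, u A x = 0 -> u' A (a A x) = 0) : cmod_hom (Ker u) (Ker u').
Proof.
refine (@CModHom C (Ker u) (Ker u')
  (fun A => (ker_fun (au A) : {additive kernel (u A) -> kernel (u' A)})) _).
by move=> A B f x; apply: kval_inj; exact: (cfun_nat a f (kval x)).
Defined.

Definition Ker_coh (C : preadditive) (addC : additive_category C)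
    (pkC : has_pseudokernels C) (F G : cohmod C) (u : hom F G) : cohmod C :=
  exist _ (Ker u) (Ker_coherent addC pkC u (proj2_sig F) (proj2_sig G)).

Lemma Ker_coh_kernel (C : preadditive) (addC : additive_category C)
    (pkC : has_pseudokernels C) (F G : cohmod C) (u : hom F G) :
  @is_kernel (cohmod C) (Ker_coh addC pkC u) F G (Ker_incl u) u.
Proof.
split; first by apply: cmod_hom_ext => A x; exact: kvalP.
move=> [X cX] /= g ug.
have gP A x : g A x \in kerp (u A).
  exact/eqP/(congr1 (fun t : cmod_hom X (sval G) => t A x) ug).
pose kf A (x : X A) : kernel (u A) := Kernel (gP A x).
have kB A : zmod_morphism (kf A) by move=> x y; apply: val_inj; rewrite /= raddfB.
pose ka A : {additive X A -> Ker u A} := HB.pack (kf A)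
  (GRing.isZmodMorphism.Build (X A) (Ker u A) (kf A) (kB A)).
have kn (A B : C) (f : phom A B) (x : X B) :
    ka A (cmap X f x) = cmap (Ker u) f (ka B x).
  by apply: val_inj; exact: (cfun_nat g f x).
exists (CModHom kn); split; first exact: cmod_hom_ext.
move=> w wg; apply: cmod_hom_ext => A x; apply: val_inj.
by rewrite /= -wg.
Qed.

Lemma eta_ker (C : preadditive) (addC : additive_category C)
    (cokC : has_cokernels C) (F G : cohmod C) (f : hom F G) (A : C)
    (x : sval F A) :
  cfun (eta addC cokC F) A x = 0 ->
  cfun (eta addC cokC G) A (cfun f A x) = 0.
Proof.
move=> x0; have e := adj_unit_nat (v_adj addC cokC) f.
have := congr1 (fun t : cmod_hom (sval F) (rep (v addC cokC G)) => t A x) e.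
move=> /= GE; apply: etrans GE _.
exact: etrans (congr1 _ x0) (raddf0 _).
Qed.

(* [F |-> Ker (eta F)] as an endofunctor of [cohmod C]; see [Ker_coh_kernel] for
   its values being kernels in [cohmod C]. *)
Definition ker_eta (C : preadditive) (addC : additive_category C)
    (cokC : has_cokernels C) (pkC : has_pseudokernels C) :
    functor (cohmod C) (cohmod C).
Proof.
refine (@Functor (cohmod C) (cohmod C)
  (fun F => Ker_coh addC pkC (eta addC cokC F))
  (fun F G f => Ker_map (@eta_ker C addC cokC F G f)) _ _).
- by move=> F; apply: cmod_hom_ext => A x; exact: kval_inj.
- by move=> F G H g f; apply: cmod_hom_ext => A x; exact: kval_inj.
Defined.

(* Regarding [ker_eta] as a functor to [umod] needs its values to lie there. This
   holds e.g. when [v] is exact, in particular for [C] abelian, but does not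
   follow from [serre (v_zero addC cokC)] alone, hence the argument [rP]. *)
Definition r (C : preadditive) (addC : additive_category C)
    (cokC : has_cokernels C) (pkC : has_pseudokernels C)
    (rP : forall F : cohmod C, v_zero addC cokC (ker_eta addC cokC pkC F)) :
    functor (cohmod C) (umod addC cokC) :=
  corestrict rP.

(* Main.v *)
From mathcomp Require Import all_boot boolp.
Require Import Defs.

(** Let [eta F : F -> R (L F)] be the unit of the adjunction between [L = v] and
    the Yoneda functor [R]. If [L X] is a zero object, then [R (L X)] is
    terminal, because arrows [A -> R (L X)] correspond to arrows [L A -> L X];
    hence [eta X = 0]. Naturality of the unit then gives
    [eta G ∘ f = R (L f) ∘ eta X = 0] for every [f : X -> G]
    ([adj_unit_comp_zero]), so [f] factors uniquely through the kernel of
    [eta G]. This kernel is itself killed by [v], which is the hypothesis [rP].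
    Thus [Ker (eta G) -> G] is terminal among the arrows to [G] from objects
    killed by [v], and by [coreflection_right_adjoint] such a natural choice of
    terminal arrows is a right adjoint of the inclusion. *)

(** The arrows [k X : K X -> X] are the would-be counit: composition with them
    is the inverse of the adjunction bijection, and their naturality makes the
    bijection natural. *)
Lemma coreflection_right_adjoint (D : category) (P : D -> Prop)
    (K : functor D D) (KP : forall X, P (K X)) (k : forall X, hom (K X) X)
    (k_nat : forall (X Y : D) (f : hom X Y), k Y ∘ fmap K f = f ∘ k X)
    (k_univ : forall (Z X : D) (f : hom Z X), P Z ->
       exists! g : hom Z (K X), k X ∘ g = f) :
  is_right_adjoint (corestrict KP) (incl P).
Proof.
pose fact (Z X : D) (PZ : P Z) (f : hom Z X) : hom Z (K X) :=
  sval (cid (k_univ Z X f PZ)).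
have factK (Z X : D) (PZ : P Z) (f : hom Z X) : k X ∘ fact Z X PZ f = f.
  by rewrite /fact; case: cid => g [].
have k_inj (Z X : D) (g h : hom Z (K X)) : P Z -> k X ∘ g = k X ∘ h -> g = h.
  move=> PZ gh; have [w [_ wu]] := k_univ _ _ (k X ∘ h) PZ.
  by rewrite -(wu g gh) -(wu h erefl).
apply: inhabits; apply: (@Adjunction _ _ (incl P) (corestrict KP)
  (fun Z X f => fact (sval Z) X (proj2_sig Z) f)).
  move=> [Z PZ] X; exists (fun g => k X ∘ g) => [f|g] /=; first exact: factK.
  by apply: k_inj => //; exact: factK.
move=> [Z PZ] [Z' PZ'] X X' f h g /=; apply: k_inj => //.
by rewrite factK !compA k_nat -(compA g (k X)) factK.
Qed.

(** By naturality of the unit [adj_unit a Y ∘ f] factors through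
    [adj_unit a X], whose target is terminal when [L X] is zero. *)
Lemma adj_unit_comp_zero (D E : category) (L : functor D E) (R : functor E D)
    (a : adjunction L R) (X Y : D) (f : hom X Y) :
  is_zero_obj (L X) -> adj_unit a Y ∘ f = zerom X (R (L Y)).
Proof.
move=> LX0; have -> : adj_unit a Y ∘ f = fmap R (fmap L f) ∘ adj_unit a X.
  exact: adj_unit_nat.
suff -> : adj_unit a X = zerom X (R (L X)) by exact: zeromR.
(* Both sides come from arrows [L X -> L X], of which there is only one. *)
have [b _ bK] := adj_bij a X (L X).
rewrite -[LHS]bK -[RHS]bK; congr (adj a _).
have [[z [_ zu]] _] := LX0 (L X).
by rewrite -(zu (b _)) // -(zu (b (zerom _ _))).
Qed.

Theorem lemma3p4 (C : preadditive) (addC : additive_category C)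
    (cokC : has_cokernels C) (pkC : has_pseudokernels C)
    (serreC : serre (v_zero addC cokC))
    (rP : forall F : cohmod C, v_zero addC cokC (ker_eta addC cokC pkC F)) :
  is_right_adjoint (r rP) (incl (v_zero addC cokC)).
Proof.
apply: (@coreflection_right_adjoint (cohmod C) _ (ker_eta addC cokC pkC) rP
  (fun F => Ker_incl (eta addC cokC F))) => [F G f|X F f X0].
  exact: cmod_hom_ext.
have [_ ker_univ] := Ker_coh_kernel addC pkC (eta addC cokC F).
by apply: ker_univ; exact: adj_unit_comp_zero.
Qed.
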